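(* Let $\lambda,\rho\in\mathbb C$ with $\rho\ne0$, and let $\{P_n\}_{n\ge0}$ and its associated sequence $\{P_n^{(1)}\}_{n\ge0}$ be the polynomial sequences given in the context (Laguerre–Hahn of class $0$, analogous to Hermite, case 2). Put $\epsilon_0=\rho$ and $\epsilon_n=n$ for $n\ge1$. Then for every $n\ge0$ the following four structure relations hold: (1) $\ (2x^2-2\lambda x+1-\rho)P_n^{(1)}+\epsilon_nP_n=P_{n+1}'+2xP_{n+1}$; (2) $\ 2\epsilon_n\big(2x^2-2\lambda x-(\rho-1)\big)P_{n-1}^{(1)}+2(2x-\lambda)P_n^{(1)}=P_{n+1}''+2xP_{n+1}'+2(n+1)P_{n+1}$; (3) $\ 2\epsilon_n\big(4x^3-4\lambda x^2-2(\rho-4)x-3\lambda\big)P_{n-1}^{(1)}+4\big(-2nx^2+2\lambda nx+n(\rho-1)+1\big)P_n^{(1)}=P_{n+1}'''+2xP_{n+1}''+2(n+2)P_{n+1}'$; (4) $\ 4\epsilon_n\big(4x^4-4\lambda x^3-2(n+\rho-7)x^2+\lambda(2n-7)x+n(\rho-1)-\rho+5\big)P_{n-1}^{(1)}+4n\big(-4x^3+4\lambda x^2+2(\rho-6)x+5\lambda\big)P_n^{(1)}=P_{n+1}^{(4)}+2xP_{n+1}'''+2(n+3)P_{n+1}''$, where $P_{n+1}^{(4)}$ denotes the fourth derivative of $P_{n+1}$.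
   Context: The monic orthogonal polynomial sequence $\{P_n\}_{n\ge0}$ is defined by $P_0(x)=1$, $P_1(x)=x-\beta_0$, $P_{n+2}(x)=(x-\beta_{n+1})P_{n+1}(x)-\gamma_{n+1}P_n(x)$ for $n\ge0$, with $\beta_0=\lambda$, $\beta_{n+1}=0$ ($n\ge0$), $\gamma_1=\rho/2$, $\gamma_{n+1}=n/2$ ($n\ge1$). The associated polynomials of order one satisfy $P_0^{(1)}(x)=1$, $P_1^{(1)}(x)=x-\beta_1$, $P^{(1)}_{n+2}(x)=(x-\beta_{n+2})P^{(1)}_{n+1}(x)-\gamma_{n+2}P^{(1)}_n(x)$ for $n\ge0$, with the same $\beta$'s and $\gamma$'s, and $P_{-1}^{(1)}=0$. Primes are $d/dx$. *)

(* Defs.v *)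
From HB Require Import structures.
From mathcomp Require Import all_boot all_order all_algebra.
From mathcomp Require Import complex.
From mathcomp Require Import reals.

Set Implicit Arguments.
Unset Strict Implicit.
Unset Printing Implicit Defensive.

Import GRing.Theory.
Local Open Scope ring_scope.

(* Monic sequence with P_0 = 1, P_1 = x - beta_0 and
   P_{n+2} = (x - beta_{n+1}) P_{n+1} - gamma_{n+1} P_n.
   The value [gamma 0] is never used. *)
Fixpoint monic_ops (F : comNzRingType) (beta gamma : nat -> F) (n : nat) :
    {poly F} :=
  match n with
  | 0 => 1
  | 1 => 'X - (beta 0%N)%:P
  | (m.+1 as k).+1 =>
      ('X - (beta k)%:P) * monic_ops beta gamma k
      - gamma k *: monic_ops beta gamma m
  end.

(* Associated sequence of order one: all recurrence coefficients are shifted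
   by one, so that P^(1)_{n+2} = (x - beta_{n+2}) P^(1)_{n+1}
   - gamma_{n+2} P^(1)_n. *)
Definition assoc_ops (F : comNzRingType) (beta gamma : nat -> F) :
    nat -> {poly F} :=
  monic_ops (fun n => beta n.+1) (fun n => gamma n.+1).

(* n |-> Q_{n-1}, with the convention Q_{-1} = 0. *)
Definition pred_seq (F : nzRingType) (Q : nat -> {poly F}) (n : nat) :
    {poly F} :=
  if n is m.+1 then Q m else 0.

Definition lh_beta (F : fieldType) (lam : F) (n : nat) : F :=
  if n is 0 then lam else 0.

(* gamma_1 = rho / 2 and gamma_{n+1} = n / 2 for n >= 1; gamma_0 is a dummy. *)
Definition lh_gamma (F : fieldType) (rho : F) (n : nat) : F :=
  match n with
  | 0 => 0
  | 1 => rho / 2%:R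
  | k.+1 => k%:R / 2%:R
  end.

Definition lh_P (F : fieldType) (lam rho : F) : nat -> {poly F} :=
  monic_ops (lh_beta lam) (lh_gamma rho).

Definition lh_P1 (F : fieldType) (lam rho : F) : nat -> {poly F} :=
  assoc_ops (lh_beta lam) (lh_gamma rho).

Definition lh_eps (F : fieldType) (rho : F) (n : nat) : F :=
  if n is 0 then rho else n%:R.

(* Main.v *)
Require Import Defs.
From HB Require Import structures.
From mathcomp Require Import all_boot all_order all_algebra.
From mathcomp Require Import complex.
From mathcomp Require Import reals.
From mathcomp Require Import ring.
Import GRing.Theory.
Local Open Scope ring_scope.

(** The associated polynomials [Q n] are the monic Hermite polynomials, so
    [(Q n)' = 2 x (Q n) - 2 (Q n.+1)]. Applying the three-term recurrences to
    both sides of (1) makes the [A * Q] parts match, and the leftover multiples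
    of [P] cancel by the recurrence of [P]; hence (1) holds by a two-step
    induction. As [eps n] is twice the recurrence coefficient linking
    [P n.+2], [P n.+1] and [P n], (1) is equivalent to
    [A * Q n = (P n.+1)' + 2 (P n.+2)], where [A := 2 x^2 - 2 lam x + 1 - rho].
    This turns the derivative of (1) into (2), and differentiating (2) twice
    gives (3) and (4). *)

(** Proves an identity modulo a hypothesis [a = b]: with the cofactor [k] supplied, a pure ring
    identity remains. Chained uses give linear combinations of hypotheses. *)
Lemma eq_subM {R : pzRingType} (k : R) {a b x y : R} :
  a = b -> x - y = k * (a - b) -> x = y.
Proof. by move=> ->; rewrite subrr mulr0; apply: subr0_eq. Qed.

Section LaguerreHahnHermite.

Variables (F : fieldType) (lam rho : F).
Hypothesis two_neq0 : 2%:R != 0 :> F.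

Let P := lh_P lam rho.
Let Q := lh_P1 lam rho.
Let eps n := (lh_eps rho n)%:P.
Let l := lam%:P.
Let r := rho%:P.
Let c : {poly F} := (2%:R^-1)%:P.

Lemma polyC_half : 2 * c = 1.
Proof. by rewrite -[2 : {poly F}]polyC_natr -polyCM mulfV. Qed.

Lemma lh_P1_rec n : Q n.+2 = 'X * Q n.+1 - c * n.+1%:R * Q n.
Proof.
rewrite /Q /lh_P1 /assoc_ops /= subr0 -mul_polyC polyCM polyC_natr.
by rewrite [_ * (_^-1)%:P]mulrC.
Qed.

Lemma lh_P_rec n : P n.+2 = 'X * P n.+1 - c * eps n * P n.
Proof.
rewrite /P /lh_P /= subr0 -mul_polyC [c * _]mulrC /c /eps -polyCM.
by case: n.
Qed.

Lemma lh_P_rec2 n : 2 * P n.+2 = 2 * 'X * P n.+1 - eps n * P n.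
Proof. by rewrite lh_P_rec mulrBr !mulrA polyC_half mul1r. Qed.

Lemma lh_P1_rec2 n : 2 * Q n.+2 = 2 * 'X * Q n.+1 - n.+1%:R * Q n.
Proof. by rewrite lh_P1_rec mulrBr !mulrA polyC_half mul1r. Qed.

Lemma deriv_lh_P1S n : (Q n.+1)^`() = n.+1%:R * Q n.
Proof.
(* Differentiating the recurrence for [Q n.+2] brings in both [(Q n.+1)^]()[and](Q n)^[()], so the
   lowering and raising forms are carried together. *)
suff [] : (Q n.+1)^`() = n.+1%:R * Q n /\
  (Q n)^`() = 2 * 'X * Q n - 2 * Q n.+1 by [].
elim: n => [|n [IH1 IH2]].
  by split; rewrite /Q /lh_P1 /assoc_ops /= !derivE; ring.
split; last by rewrite IH1 lh_P1_rec2; ring.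
rewrite lh_P1_rec derivB !derivM derivX derivC -polyC_natr derivC polyC_natr.
rewrite IH1 IH2.
by apply: (eq_subM (- n.+1%:R * ('X * Q n - Q n.+1)) polyC_half); ring.
Qed.

Lemma deriv_lh_P1 n : (Q n)^`() = 2 * 'X * Q n - 2 * Q n.+1.
Proof.
case: n => [|n]; last by rewrite deriv_lh_P1S lh_P1_rec2; ring.
by rewrite /Q /lh_P1 /assoc_ops /= !derivE; ring.
Qed.

Let A : {poly F} := 2 * 'X^2 - 2 * l * 'X + 1 - r.

Lemma deriv_structure_factor : A^`() = 2 * (2 * 'X - l).
Proof.
by rewrite /A /l /r !derivE; ring.
Qed.

Lemma deriv_lh_PSS n :
  (P n.+2)^`() = P n.+1 + 'X * (P n.+1)^`() - c * eps n * (P n)^`().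
Proof. by rewrite lh_P_rec derivB !derivM derivX !derivC; ring. Qed.

Lemma structure_relation1 n :
  A * Q n + eps n * P n = (P n.+1)^`() + 2 * 'X * P n.+1.
Proof.
(* The recurrences giving [P n.+3] and [Q n.+2] share the coefficient [c * n.+1%:R]; one index
   lower, [P] may involve [rho], so indices 0 and 1 are checked directly. *)
suff [] : A * Q n + eps n * P n = (P n.+1)^`() + 2 * 'X * P n.+1 /\
  A * Q n.+1 + eps n.+1 * P n.+1 = (P n.+2)^`() + 2 * 'X * P n.+2 by [].
elim: n => [|n [IH1 IH2]].
  rewrite deriv_lh_PSS lh_P_rec /eps /= polyC_natr.
  rewrite /A /P /Q /lh_P /lh_P1 /assoc_ops /= !derivE; split; first by ring.
  by apply: (eq_subM (r * 'X) polyC_half); ring.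
split=> //; rewrite deriv_lh_PSS lh_P1_rec [P n.+3]lh_P_rec.
move: IH1 IH2 (lh_P_rec n); rewrite {2 3 4 5}/eps /= !polyC_natr => IH1 IH2 recP.
apply: (eq_subM 'X IH2).
apply: (eq_subM (- (c * n.+1%:R)) IH1).
by apply: (eq_subM n.+1%:R recP); ring.
Qed.

Lemma structure_relation1_pred n : A * Q n = (P n.+1)^`() + 2 * P n.+2.
Proof.
rewrite lh_P_rec2 -[LHS](addrK (eps n * P n)) structure_relation1.
by rewrite addrA.
Qed.

Lemma structure_relation2 n :
  2 * eps n * A * pred_seq Q n + 2 * (2 * 'X - l) * Q n
  = (P n.+1)^`(2) + 2 * 'X * (P n.+1)^`() + 2 * (n%:R + 1) * P n.+1.
Proof.
case: n => [|n].
  by rewrite /P /Q /lh_P /lh_P1 /assoc_ops /= !derivE; ring.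
move: (structure_relation1 n.+1) (structure_relation1_pred n) (deriv_lh_P1S n).
rewrite /eps /= polyC_natr.
move: (P n.+2) (P n.+1) (Q n.+1) (Q n) => p2 p1 q1 q0.
move: A deriv_structure_factor => a da E1 E1pred dq1.
have /= := congr1 (@deriv F) E1.
rewrite !derivE da dq1 => dE1.
apply: (eq_subM 1 dE1).
by apply: (eq_subM n.+1%:R E1pred); ring.
Qed.

(** For positive [n], the span of [Q n] and [Q n.-1] over the polynomials is closed under
    differentiation, so differentiating (2) only changes the coefficients. The same holds from (3)
    to (4). *)
Lemma structure_relation3 n :
  2 * eps n * (4 * 'X^3 - 4 * l * 'X^2 - 2 * (r - 4) * 'X - 3 * l) * pred_seq Q n
    + 4 * (- (2 * n%:R * 'X^2) + 2 * l * n%:R * 'X + n%:R * (r - 1) + 1) * Q n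
  = (P n.+1)^`(3) + 2 * 'X * (P n.+1)^`(2) + 2 * (n%:R + 2) * (P n.+1)^`().
Proof.
case: n => [|n].
  by rewrite /P /Q /lh_P /lh_P1 /assoc_ops /= !derivE; ring.
move: (structure_relation2 n.+1) (deriv_lh_P1S n) (deriv_lh_P1 n).
rewrite /A /eps /= polyC_natr.
move: (P n.+2) (Q n.+1) (Q n) => p2 q1 q0 E dq1 dq0.
have /= := congr1 (@deriv F) E.
rewrite /l /r !derivE dq1 dq0 => dE.
by apply: (eq_subM 1 dE); ring.
Qed.

Lemma structure_relation4 n :
  4 * eps n * (4 * 'X^4 - 4 * l * 'X^3 - 2 * (n%:R + r - 7) * 'X^2
               + l * (2 * n%:R - 7) * 'X + n%:R * (r - 1) - r + 5) * pred_seq Q n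
    + 4 * n%:R * (- (4 * 'X^3) + 4 * l * 'X^2 + 2 * (r - 6) * 'X + 5 * l) * Q n
  = (P n.+1)^`(4) + 2 * 'X * (P n.+1)^`(3) + 2 * (n%:R + 3) * (P n.+1)^`(2).
Proof.
case: n => [|n].
  (* At index 0 both sides vanish, [P 1] being linear. *)
  by rewrite /P /Q /lh_P /lh_P1 /assoc_ops /= !derivE; ring.
move: (structure_relation3 n.+1) (deriv_lh_P1S n) (deriv_lh_P1 n).
rewrite /A /eps /= polyC_natr.
move: (P n.+2) (Q n.+1) (Q n) => p2 q1 q0 E dq1 dq0.
have /= := congr1 (@deriv F) E.
rewrite /l /r !derivE dq1 dq0 => dE.
by apply: (eq_subM 1 dE); ring.
Qed.

End LaguerreHahnHermite.

Theorem mainTheorem7 (R : realType) (lam rho : R[i]) (rho_neq0 : rho != 0)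
    (n : nat) :
  let P := lh_P lam rho in
  let Q := lh_P1 lam rho in
  let Qm1 := pred_seq Q n in
  let eps := (lh_eps rho n)%:P in
  let l := lam%:P in
  let r := rho%:P in
  let N := n%:R : {poly R[i]} in
  [/\ (2 * 'X^2 - 2 * l * 'X + 1 - r) * Q n + eps * P n
      = (P n.+1)^`() + 2 * 'X * P n.+1,

      2 * eps * (2 * 'X^2 - 2 * l * 'X - (r - 1)) * Qm1
        + 2 * (2 * 'X - l) * Q n
      = (P n.+1)^`(2) + 2 * 'X * (P n.+1)^`() + 2 * (N + 1) * P n.+1,

      2 * eps * (4 * 'X^3 - 4 * l * 'X^2 - 2 * (r - 4) * 'X - 3 * l) * Qm1
        + 4 * (- (2 * N * 'X^2) + 2 * l * N * 'X + N * (r - 1) + 1) * Q n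
      = (P n.+1)^`(3) + 2 * 'X * (P n.+1)^`(2) + 2 * (N + 2) * (P n.+1)^`()
    & 4 * eps * (4 * 'X^4 - 4 * l * 'X^3 - 2 * (N + r - 7) * 'X^2
                 + l * (2 * N - 7) * 'X + N * (r - 1) - r + 5) * Qm1
        + 4 * N * (- (4 * 'X^3) + 4 * l * 'X^2 + 2 * (r - 6) * 'X + 5 * l) * Q n
      = (P n.+1)^`(4) + 2 * 'X * (P n.+1)^`(3) + 2 * (N + 3) * (P n.+1)^`(2)].

Proof.
have two_neq0 : 2%:R != 0 :> R[i] by rewrite Num.Theory.pnatr_eq0.
split.
- exact: structure_relation1.
- by rewrite -(structure_relation2 _ _ _ two_neq0); ring.
- exact: structure_relation3.
- exact: structure_relation4.
Qed.
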